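(* Let $\gamma\in(0,2\beta_V)$, let $\alpha:=\frac{2\beta_V}{4\beta_V-\gamma}$, let $(\lambda_j)_{j\ge0}\subseteq(0,1/\alpha)$, let $z^0\in\mathcal H$, let $(z^j)_{j\ge0}$ be generated by the FDRS iteration $z^{k+1}=T_{\lambda_k}(z^k)$, let $z^*$ be a fixed point of $T$, and let $x^*:=P_Vz^*$. Let $c>1/2$, let $\gamma<\beta_V/c$, and let $(\lambda_j)_{j\ge0}\subseteq(0,(2c-1)/c)$. For all $\lambda\in(0,(2c-1)/c)$, define (when $\mu_g\beta_f>0$, respectively $\mu_f\beta_f>0$) $$C_1(\lambda):=\left(1-\frac\lambda3\min\left\{\frac{\gamma\mu_g}{(1+\gamma/\beta_V)^2},\frac{\beta_f}\gamma,\frac{2c-1}c-\lambda\right\}\right)^{1/2},$$ $$C_2(\lambda):=\left(1-\frac\lambda3\min\left\{\frac{\gamma\mu_f}{(1+\gamma/\beta_f)^2},\frac{\beta_V-c\gamma}\gamma,\frac14\left(\frac{2c-1}c-\lambda\right)\right\}\right)^{1/2}.$$ Then for all $k\ge0$: (i) if $\mu_g\beta_f>0$, then $\|z^{k+1}-z^*\|\le C_1(\lambda_k)\|z^k-z^*\|$ and $\|z^{k+1}-z^*\|\le\|z^0-z^*\|\prod_{i=0}^kC_1(\lambda_i)$; (ii) if $\mu_f\beta_f>0$, then $\|z^{k+1}-z^*\|\le C_2(\lambda_k)\|z^k-z^*\|$ and $\|z^{k+1}-z^*\|\le\|z^0-z^*\|\prod_{i=0}^kC_2(\lambda_i)$.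
   Context: $\mathcal H$ is a real Hilbert space with identity map $I$; $V\subseteq\mathcal H$ is a closed vector subspace; $P_V,P_{V^\perp}$ are the orthogonal projections onto $V$ and $V^\perp$; $\chi_V$ is the indicator function of $V$ ($0$ on $V$, $+\infty$ elsewhere), so $\partial\chi_V(x)=V^\perp$ for $x\in V$ and $\emptyset$ otherwise. Standing assumptions: $f,g:\mathcal H\to(-\infty,\infty]$ are closed, proper and convex; $g$ is differentiable on $\mathcal H$ and $\nabla g$ is $(1/\beta)$-Lipschitz, $\beta>0$; $h:=g\circ P_V$, so $\nabla h=P_V\circ\nabla g\circ P_V$, and $\beta_V>0$ is such that $\nabla h$ is $(1/\beta_V)$-Lipschitz; there exists $x$ with $0\in\partial f(x)+\nabla g(x)+\partial\chi_V(x)$. The functions $f$ and $g$ are $\mu_f$- and $\mu_g$-strongly convex with $\mu_f,\mu_g\ge0$ (value $0$ means no strong convexity is assumed). Moreover $\beta_f\ge0$; if $\beta_f>0$ then $f$ is differentiable on $\mathcal H$ with $(1/\beta_f)$-Lipschitz gradient, while $\beta_f=0$ means no differentiability of $f$ is assumed. For $\gamma>0$: $\mathrm{prox}_{\gamma f}(x):=\arg\min_{y}\left(f(y)+\frac1{2\gamma}\|y-x\|^2\right)$, $\mathrm{refl}_{\gamma f}:=2\,\mathrm{prox}_{\gamma f}-I$, $\mathrm{refl}_{\chi_V}:=2P_V-I$. The FDRS operator is $T:=\left(\frac12I+\frac12\mathrm{refl}_{\gamma f}\circ\mathrm{refl}_{\chi_V}\right)\circ(I-\gamma\nabla h)$,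 and $T_\lambda:=(1-\lambda)I+\lambda T$. The FDRS iteration from $z^0\in\mathcal H$ with relaxation parameters $(\lambda_j)_{j\ge0}$ is $z^{k+1}=T_{\lambda_k}(z^k)$, $k\ge0$. *)

(* Defs.v *)
From mathcomp Require Export all_boot all_order all_algebra.
From mathcomp Require Export all_classical all_reals all_analysis.
Set Implicit Arguments.
Unset Strict Implicit.
Unset Printing Implicit Defensive.
Export Order.TTheory GRing.Theory Num.Theory.
Export numFieldNormedType.Exports.
Local Open Scope classical_set_scope.
Local Open Scope ring_scope.

Section FDRS.
Context {R : realType} {H : completeNormedModType R}.
Implicit Types (ip : {dot H for (@idfun R)}) (V : set H) (f g : H -> \bar R).
Implicit Types (x y : H) (gamma mu : R).

(* A complete normed space whose norm comes from the inner product [ip] is a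
   real Hilbert space. *)
Definition norm_induced_by ip := forall x, `|x| ^+ 2 = ip x x.

Definition proper_efun f := (forall x, f x != -oo%E) /\ (exists x, f x != +oo%E).

Definition convex_efun f := forall x y (t : R), 0 < t < 1 ->
  (f (t *: x + (1 - t) *: y)%R <= t%:E * f x + (1 - t)%:E * f y)%E.

Definition closed_proper_convex f :=
  [/\ lower_semicontinuous f, proper_efun f & convex_efun f].

(* For mu = 0 this is plain convexity. *)
Definition strongly_convex mu f := forall x y (t : R), 0 < t < 1 ->
  (f (t *: x + (1 - t) *: y)%R + (mu / 2 * (t * (1 - t)) * `|x - y| ^+ 2)%:E
   <= t%:E * f x + (1 - t)%:E * f y)%E.

Definition differentiable_everywhere f := forall x,
  f x \is a fin_num /\ differentiable (fine \o f : H -> R^o) x.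

(* The Riesz representative of the Frechet differential; it exists and is
   unique wherever f is differentiable. *)
Definition gradient ip f x : H :=
  get [set v | 'd (fine \o f : H -> R^o) x = ip v :> (H -> R^o)].

Definition subdifferential ip f x : set H :=
  [set u | forall y, (f x + (ip u (y - x))%:E <= f y)%E].

Definition indicator V x : \bar R := if x \in V then 0%E else +oo%E.

(* Well defined when V is a closed subspace: the point p exists and is unique
   by the projection theorem. *)
Definition orthogonal_projection ip V x : H :=
  get [set p | V p /\ forall v, V v -> ip (x - p) v = 0].

(* The argmin of f + (1 / (2 gamma)) |. - x|^2, which is a single point when f is
   closed, proper and convex and gamma > 0. *)
Definition prox gamma f x : H :=
  get [set p | forall y,
    (f p + ((2 * gamma)^-1 * `|p - x| ^+ 2)%:E
     <= f y + ((2 * gamma)^-1 * `|y - x| ^+ 2)%:E)%E].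

Definition refl_prox gamma f x : H := 2 *: prox gamma f x - x.

Definition refl_subspace ip V x : H := 2 *: orthogonal_projection ip V x - x.

Definition fdrs ip V gamma f g (x : H) : H :=
  let h := g \o orthogonal_projection ip V in
  let w := x - gamma *: gradient ip h x in
  2^-1 *: w + 2^-1 *: refl_prox gamma f (refl_subspace ip V w).

Definition fdrs_relaxed ip V gamma f g (lambda : R) (x : H) : H :=
  (1 - lambda) *: x + lambda *: fdrs ip V gamma f g x.

End FDRS.

Definition C1 {R : realType} (gamma c betaV betaf mug lambda : R) : R :=
  Num.sqrt (1 - lambda / 3 *
    Num.min (gamma * mug / (1 + gamma / betaV) ^+ 2)
      (Num.min (betaf / gamma) ((2 * c - 1) / c - lambda))).

Definition C2 {R : realType} (gamma c betaV betaf muf lambda : R) : R :=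
  Num.sqrt (1 - lambda / 3 *
    Num.min (gamma * muf / (1 + gamma / betaf) ^+ 2)
      (Num.min ((betaV - c * gamma) / gamma)
        (1 / 4 * ((2 * c - 1) / c - lambda)))).

(* Main.v *)
Require Import Defs.
From HB Require Import structures.
From mathcomp Require Import ring lra.
Set Implicit Arguments.
Unset Strict Implicit.
Unset Printing Implicit Defensive.
Local Open Scope classical_set_scope.
Local Open Scope ring_scope.

(** Write [P] for the projection onto [V], [xh = P z], [xf] for the proximal
    point computed from [z] and [h = g \o P].  Since [gradient ip h] takes its
    values in [V], the operator is [T z = z + xf - xh] (lemma [fdrsE]), so a
    fixed point [zs] has [xf = xh = P zs].  Take the differences
    [d = z - zs], [a = xf - P zs], [b = xh - P zs], let [G] be the difference of
    the gradients of [h] at [z] and [zs], and [U] the difference of the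
    subgradients of [f] that the two proximal points select.  Then
    [gamma U = 2 b - a - gamma G - d], the relaxed step turns [d] into
    [d + lambda (a - b)], and [b] is the projection of [d].  Expanding the square
    and absorbing the only indefinite term [- 2 gamma <a - b, G>] by Young's
    inequality with weight [c] gives, in [fdrs_step_bound],

      |d + lambda (a - b)|^2 <= |d|^2 - lambda (((2 c - 1) / c - lambda) |a - b|^2
        + 2 gamma <a, U> + 2 gamma <b, G> - c gamma^2 |G|^2).

    By monotonicity [<b, G>] dominates [betaV |G|^2] and [mug |b|^2], and [<a, U>]
    dominates [betaf |U|^2] and [muf |a|^2]; since [c gamma < betaV], the decrease
    is then a sum of nonnegative terms.  A linear rate follows once it controls
    [|d|^2].  For
    this [d] is cut into three pieces with the resolvent equation:
    [d = - (a - b) - gamma U + (b - gamma G)] when [g] is strongly convex, and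
    [d = - 2 (a - b) + (a - gamma U) - gamma G] when [f] is.  The inequality
    [|x + y + z|^2 <= 3 (|x|^2 + |y|^2 + |z|^2)] explains the factor [1 / 3] of
    the rates, and each entry of the minimum bounds from below the ratio between a
    term of the decrease and the matching piece.

    The analytic input is the existence of projections, proximal points and
    gradients, which are three instances of one minimisation principle
    ([strongly_convex_minimizer]), and the cocoercivity of Lipschitz gradients of
    convex functions ([baillon_haddad]).  Both rates assume [betaf > 0], so [f] is
    finite and everywhere differentiable, and the whole argument runs with
    real-valued functions. *)

(** * Minimisation in a complete normed space *)

(** First-order conditions are read off from variations of size [t]: the terms
    quadratic in [t] disappear in the limit. *)
Lemma le_of_small_error {R : realFieldType} (a b c : R) :
  (forall t, 0 < t < 1 -> a <= b + t * c) -> a <= b.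
Proof.
move=> le_abc; apply/ler_addgt0Pr => e e0.
pose t := e / (e + `|c| + 1).
have c0 : 0 <= `|c| by [].
have d0 : 0 < e + `|c| + 1 by lra.
have t01 : 0 < t < 1 by rewrite divr_gt0//= ltr_pdivrMr// mul1r; lra.
apply: (le_trans (le_abc t t01)); rewrite lerD2l /t mulrAC ler_pdivrMr//.
by rewrite ler_pM2l//; have := ler_norm c; lra.
Qed.

Section Minimisation.
Context {R : realType} {H : completeNormedModType R}.

(** The convexity gap at midpoints makes the sublevel sets just above the infimum
    of arbitrarily small diameter, so they generate a Cauchy filter; its limit
    is the minimizer. *)
Lemma strongly_convex_minimizer (C : set H) (F : H -> R) (m b : R) :
  0 < m -> closed C -> C !=set0 -> continuous F ->
  (forall x, C x -> b <= F x) ->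
  (forall x y, C x -> C y -> C (2^-1 *: (x + y)) /\
     F (2^-1 *: (x + y)) + m * `|x - y| ^+ 2 <= (F x + F y) / 2) ->
  exists2 p, C p & forall y, C y -> F p <= F y.
Proof.
move=> m0 clC [x0 Cx0] ctsF bF midF.
have infF : has_inf (F @` C).
  by split; [exists (F x0), x0 | exists b => _ [x Cx <-]; exact: bF].
pose i := inf (F @` C).
have iF x : C x -> i <= F x by move=> Cx; apply: ge_inf; [case: infF | exists x].
pose S (e : R) := [set x | C x /\ F x <= i + e].
have S_ne e : 0 < e -> S e !=set0.
  move=> e0; have [_ [x Cx <-] /ltW xe] := inf_adherent e0 infF.
  by exists x.
pose FF := filter_from [set e : R | 0 < e] S.
have pFF : ProperFilter FF.
  apply: filter_from_proper => //; apply: filter_from_filter.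
    by exists 1; rewrite /= ltr01.
  move=> e1 e2 /= e10 e20; exists (Num.min e1 e2).
    by rewrite /= lt_min e10.
  by move=> x [Cx]; rewrite -lerBlDl le_min !lerBlDl => /andP[? ?]; do !split.
have cauFF : cauchy FF.
  apply: cauchy_exP => e e0.
  have e'0 : 0 < m * e ^+ 2 / 2 by rewrite divr_gt0// mulr_gt0// exprn_gt0.
  have [x [Cx Fx]] := S_ne _ e'0.
  exists x, (m * e ^+ 2 / 2) => // y [Cy Fy].
  have [/iF imid mid] := midF _ _ Cx Cy.
  rewrite -ball_normE /= -(ltr_pXn2r (ltn0Sn 1)) ?nnegrE ?(ltW e0)//.
  rewrite -(ltr_pM2l m0); move: e'0 imid mid Fx Fy.
  set A := F x; set B := F y; set D := F _; set q := m * _; set q2 := m * _.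
  by lra.
have cvFF : FF --> lim FF by exact: cauchy_cvg.
have Clim : C (lim FF).
  apply: (closed_cvg (F := FF) (u_ := id) C) => //.
  by exists 1; [exact: ltr01 | move=> x []].
exists (lim FF) => // y Cy; apply: le_trans (iF _ Cy).
apply/ler_addgt0Pr => e e0.
apply: (@cvgr_to_le _ FF pFF R F); first exact: (cvg_comp _ _ cvFF (ctsF _)).
by exists e => // x [].
Qed.

End Minimisation.

(** * Inner products and the Riesz representation *)

Section InnerProduct.
Context {R : realType} {H : completeNormedModType R}.
Context (ip : {dot H for (@idfun R)}) (hip : norm_induced_by ip).
Implicit Types (x y u v p : H) (a t : R).

Lemma ipC x y : ip x y = ip y x.
Proof. by rewrite (hermC ip x y) expr0 mul1r. Qed.
Lemma ipDl x y v : ip (x + y) v = ip x v + ip y v.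
Proof. exact: linearDl. Qed.
Lemma ipNl x v : ip (- x) v = - ip x v.
Proof. exact: linearNl. Qed.
Lemma ipZl a x v : ip (a *: x) v = a * ip x v.
Proof. exact: linearZl_LR. Qed.
Lemma ipDr v x y : ip v (x + y) = ip v x + ip v y.
Proof. exact: linearDr. Qed.
Lemma ipNr v x : ip v (- x) = - ip v x.
Proof. exact: linearNr. Qed.
Lemma ipZr a v x : ip v (a *: x) = a * ip v x.
Proof. by rewrite ipC ipZl ipC. Qed.

Definition ipE := (ipDl, ipDr, ipNl, ipNr, ipZl, ipZr).

Lemma ip_ge0 x : 0 <= ip x x.
Proof. by rewrite -hip exprn_ge0. Qed.

Lemma ip_eq0 x : ip x x = 0 -> x = 0.
Proof. by rewrite -hip => /eqP; rewrite expf_eq0/= normr_eq0 => /eqP. Qed.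

(** Testing against all vectors reduces vector identities to identities between
    scalars, which [ring] and [field] decide. *)
Lemma ip_inj x y : (forall v, ip x v = ip y v) -> x = y.
Proof.
move=> xy; apply/eqP; rewrite -subr_eq0; apply/eqP/ip_eq0.
by rewrite ipDl ipNl xy subrr.
Qed.

(** Cauchy-Schwarz is the square of the triangle inequality. *)
Lemma ip_le_norm x y : ip x y <= `|x| * `|y|.
Proof.
have : `|x + y| ^+ 2 <= (`|x| + `|y|) ^+ 2.
  by rewrite ler_pXn2r ?nnegrE ?addr_ge0// ler_normD.
by rewrite hip !ipE (ipC y x) sqrrD !hip mulr2n; lra.
Qed.

(** Riesz: the representative of [l] minimizes [|x|^2 / 2 - l x], and the equation
    [l = ip v] is its stationarity condition. *)
Lemma linear_functional_representation (l : {linear H -> R^o}) :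
  continuous l -> exists v, l = ip v :> (H -> R^o).
Proof.
move=> ctsl; pose F x := `|x| ^+ 2 / 2 - (l x : R).
have lD x y : (l (x + y) : R) = (l x : R) + l y by exact: linearD.
have lZ a x : (l (a *: x) : R) = a * (l x : R) by exact: linearZ.
have [M lM] : exists M : R, forall x, (l x : R) <= M * `|x|.
  have /linear_boundedP[M [Mr lM]] := (linear_bounded_continuous l).2 ctsl.
  exists (`|M| + 1) => x; apply: (le_trans (ler_norm _)).
  by apply: lM; rewrite (le_lt_trans (ler_norm M))// ltrDl.
have ctsF : continuous F.
  move=> x; apply: cvgB; last exact: ctsl.
  apply: cvgMl; apply: (@continuous_comp _ _ _ (fun y => `|y|) (fun r => r ^+ 2)).
    exact: norm_continuous.
  exact: exprn_continuous.
have bF x : setT x -> - (M ^+ 2 / 2) <= F x.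
  move=> _; have := sqr_ge0 (`|x| - M); have := lM x.
  by rewrite /F sqrrB mulr2n; set d : R := l x; lra.
have midF x y : setT x -> setT y -> setT (2^-1 *: (x + y)) /\
    F (2^-1 *: (x + y)) + 8^-1 * `|x - y| ^+ 2 <= (F x + F y) / 2.
  move=> _ _; split=> //.
  by rewrite /F lZ lD !hip !ipE (ipC y x); lra.
have [||p _ minp] := strongly_convex_minimizer _ closedT _ ctsF bF midF.
- by rewrite invr_gt0.
- by exists 0.
exists p; apply/funext => k.
have stat k' : l k' <= ip p k'.
  apply: (@le_of_small_error _ _ _ (ip k' k' / 2)) => t /andP[t0 _].
  have := minp (p + t *: k') I.
  rewrite /F lD lZ !hip !ipE (ipC k' p) => ineq.
  by rewrite -(ler_pM2l t0); nra.
apply/eqP; rewrite eq_le stat/=; have := stat (- k).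
by rewrite ipNr linearN lerN2.
Qed.

Lemma norm_sum3_sqr x y z :
  `|x + y + z| ^+ 2 <= 3 * (`|x| ^+ 2 + `|y| ^+ 2 + `|z| ^+ 2).
Proof.
have := ip_ge0 (x - y); have := ip_ge0 (y - z); have := ip_ge0 (z - x).
rewrite !hip !ipE (ipC y x) (ipC z x) (ipC z y); lra.
Qed.

End InnerProduct.

(** * Orthogonal projection onto a closed subspace *)

Section Projection.
Context {R : realType} {H : completeNormedModType R}.
Context (ip : {dot H for (@idfun R)}) (hip : norm_induced_by ip).
Context (V : set H) (hV : submod_closed (mem V)) (hVcl : closed V).
Implicit Types (x y u v p : H) (a t : R).

Let V_0 : V 0.
Proof. by have [] := hV; rewrite inE. Qed.

Let V_lin a u v : V u -> V v -> V (a *: u + v).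
Proof.
have [_ VL] := hV; move=> Vu Vv; have := VL a u v.
by rewrite !inE; apply.
Qed.

Let V_D u v : V u -> V v -> V (u + v).
Proof. by rewrite -{2}(scale1r u); exact: V_lin. Qed.

Let V_Z a u : V u -> V (a *: u).
Proof. by move=> Vu; rewrite -(addr0 (a *: u)); exact: V_lin. Qed.

Let P := orthogonal_projection ip V.

Lemma projection_spec x : V (P x) /\ forall v, V v -> ip (x - P x) v = 0.
Proof.
apply: (@getPex _ [set p | V p /\ forall v, V v -> ip (x - p) v = 0]).
pose F y := `|x - y| ^+ 2.
have ctsF : continuous F.
  move=> y; apply: (@continuous_comp _ _ _ (fun y => `|x - y|) (fun r => r ^+ 2)).
    apply: continuous_comp; last exact: norm_continuous.
    by apply: cvgB => //; exact: cvg_cst.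
  exact: exprn_continuous.
have bF y : V y -> 0 <= F y by rewrite exprn_ge0.
have midF y z : V y -> V z -> V (2^-1 *: (y + z)) /\
    F (2^-1 *: (y + z)) + 4^-1 * `|y - z| ^+ 2 <= (F y + F z) / 2.
  move=> Vy Vz; split; first by apply/V_Z/V_D.
  rewrite /F !hip !ipE (ipC ip z y) (ipC ip z x) (ipC ip y x); lra.
have [||p Vp minp] := strongly_convex_minimizer _ hVcl _ ctsF bF midF.
- by rewrite invr_gt0.
- by exists 0.
exists p; split => // v Vv.
have stat w : V w -> ip (x - p) w <= 0.
  move=> Vw; apply: (@le_of_small_error _ _ _ (ip w w / 2)) => t /andP[t0 _].
  have := minp (p + t *: w) (V_D Vp (V_Z t Vw)).
  rewrite /F; have -> : x - (p + t *: w) = (x - p) - t *: w by rewrite opprD addrA.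
  rewrite !hip; move: (x - p) => y; rewrite !ipE (ipC ip w y) => ineq.
  by rewrite -(ler_pM2l t0); nra.
apply/eqP; rewrite eq_le stat//=; have := stat (- v).
by rewrite ipNr oppr_le0; apply; rewrite -scaleN1r; exact: V_Z.
Qed.

Lemma projection_in x : V (P x).
Proof. by have [] := projection_spec x. Qed.

Lemma projection_ortho x v : V v -> ip x v = ip (P x) v.
Proof.
move=> Vv; have [_ /(_ v Vv)] := projection_spec x.
by rewrite !ipE => /eqP; rewrite subr_eq0 => /eqP.
Qed.

Lemma projection_unique x p : V p -> (forall v, V v -> ip x v = ip p v) -> P x = p.
Proof.
move=> Vp xp; apply/eqP; rewrite -subr_eq0; apply/eqP/(ip_eq0 hip).
rewrite ipDl ipNl -xp ?(projection_ortho x) ?subrr//.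
all: rewrite -scaleN1r addrC; apply: V_lin => //; exact: projection_in.
Qed.

Lemma projection_id x : V x -> P x = x.
Proof. by move=> Vx; exact: projection_unique. Qed.

Lemma projection_linear : linear P.
Proof.
move=> a x y; apply: projection_unique.
  by apply: V_lin; exact: projection_in.
by move=> v Vv; rewrite !ipE (projection_ortho x Vv) (projection_ortho y Vv).
Qed.

Lemma projectionD x y : P (x + y) = P x + P y.
Proof. by rewrite -{1}(scale1r x) projection_linear scale1r. Qed.

Lemma projectionZ a x : P (a *: x) = a *: P x.
Proof.
by rewrite -{1}(addr0 (a *: x)) projection_linear (projection_id V_0) addr0.
Qed.

Lemma projectionN x : P (- x) = - P x.
Proof. by rewrite -scaleN1r projectionZ scaleN1r. Qed.

Lemma projection_self_adjoint x y : ip (P x) y = ip x (P y).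
Proof.
rewrite (projection_ortho x (projection_in y)).
by rewrite ipC (projection_ortho y (projection_in x)) ipC.
Qed.

Lemma projection_norm x : `|P x| <= `|x|.
Proof.
have [->//|Px0] := eqVneq (P x) 0; first by rewrite normr0.
rewrite -(@ler_pM2r _ `|P x|) ?normr_gt0// -expr2 hip.
by rewrite -(projection_ortho x (projection_in x)) (ip_le_norm hip).
Qed.

End Projection.

(** * Gradients and subgradients *)

Section Gradient.
Context {R : realType} {H : completeNormedModType R}.
Context (ip : {dot H for (@idfun R)}) (hip : norm_induced_by ip).
Implicit Types (f : H -> \bar R) (F : H -> R) (x y u v k : H).

Lemma differential_gradient f x :
  differentiable (fine \o f : H -> R^o) x ->
  'd (fine \o f : H -> R^o) x = ip (gradient ip f x) :> (H -> R^o).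
Proof.
move=> df; apply: (@getPex _ [set v | 'd (fine \o f : H -> R^o) x = ip v :> (H -> R^o)]).
by apply: (linear_functional_representation hip); exact: diff_continuous.
Qed.

Lemma gradient_eq f x v :
  'd (fine \o f : H -> R^o) x = ip v :> (H -> R^o) -> gradient ip f x = v.
Proof.
move=> dv; have :=
  @getI _ [set v | 'd (fine \o f : H -> R^o) x = ip v :> (H -> R^o)] v dv.
rewrite -/(gradient ip f x) /= dv => dg; apply: (ip_inj hip) => w.
by have := congr1 (fun l => l w) dg.
Qed.

(** A single small [t] per error [e] suffices for the comparisons below, since
    convexity inequalities hold for every [t] between [0] and [1]. *)
Lemma directional_approximation F x k e :
  differentiable (F : H -> R^o) x -> 0 < e ->
  exists2 t, 0 < t < 1 &
    `|F (x + t *: k) - F x - t * ('d (F : H -> R^o) x k : R)| <= t * e.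
Proof.
move=> dF e0; have /cvgrPdist_le/(_ e e0) := diff_derivable (v := k) dF.
rewrite -/('D_k (F : H -> R^o) x) deriveE// => -[d /= d0 near_d].
pose t := Num.min (d / 2) 2^-1.
have t0 : 0 < t by rewrite lt_min divr_gt0//= invr_gt0.
exists t.
  by rewrite t0/= gt_min; apply/orP; right; lra.
have /near_d : ball_ Num.norm 0 d t.
  rewrite /ball_/= sub0r normrN gtr0_norm// gt_min; apply/orP; left; lra.
move=> /(_ (lt0r_neq0 t0)).
rewrite /= /GRing.scale/= => le_e.
have -> : F (x + t *: k) - F x - t * ('d (F : H -> R^o) x k : R) =
  - (t * (('d (F : H -> R^o) x k : R) - t^-1 * (F (t *: k + x) - F x))).
  by rewrite (addrC (t *: k)); field; exact: lt0r_neq0.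
by rewrite normrN normrM gtr0_norm// ler_pM2l.
Qed.

Definition subgradient F x u := forall y, F x + ip u (y - x) <= F y.

(** Convexity of a real function is the case [mu = 0]. *)
Definition real_strongly_convex mu F := forall x y t, 0 < t < 1 ->
  F (t *: x + (1 - t) *: y) + mu / 2 * (t * (1 - t)) * `|x - y| ^+ 2
    <= t * F x + (1 - t) * F y.

Lemma fine_strongly_convex mu f : (forall x, f x \is a fin_num) ->
  strongly_convex mu f -> real_strongly_convex mu (fine \o f).
Proof.
move=> finf scf x y t t01; have := scf x y t t01.
by rewrite -(fineK (finf _)) -(fineK (finf x)) -(fineK (finf y)) -!EFinM -!EFinD lee_fin.
Qed.

Lemma fine_convex f : (forall x, f x \is a fin_num) ->
  convex_efun f -> real_strongly_convex 0 (fine \o f).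
Proof.
move=> finf cf x y t t01; have := cf x y t t01.
rewrite -(fineK (finf _)) -(fineK (finf x)) -(fineK (finf y)) -!EFinM -!EFinD lee_fin.
by rewrite !mul0r addr0.
Qed.

(** Difference quotients of a convex function along a segment lie below the
    increment over the whole segment, and so does their limit. *)
Lemma differential_subgradient F x u : real_strongly_convex 0 F ->
  differentiable (F : H -> R^o) x -> 'd (F : H -> R^o) x = ip u :> (H -> R^o) ->
  subgradient F x u.
Proof.
move=> cF dF dFu y; apply/ler_addgt0Pr => e e0.
have [t t01] := directional_approximation (y - x) dF e0.
have /andP[t0 _] := t01.
rewrite dFu ler_norml => /andP[approx _].
have := cF y x t t01; rewrite !mul0r addr0.
have -> : t *: y + (1 - t) *: x = x + t *: (y - x).
  by rewrite scalerBl scale1r scalerBr addrCA.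
by move=> conv; rewrite -(ler_pM2l t0); lra.
Qed.

(** A linear form below the increments of [F] lies below its differential in
    every direction, hence equals it. *)
Lemma subgradient_differential F x u v :
  differentiable (F : H -> R^o) x -> 'd (F : H -> R^o) x = ip u :> (H -> R^o) ->
  subgradient F x v -> v = u.
Proof.
move=> dF dFu sgv; apply: (ip_inj hip).
have le_vu k : ip v k <= ip u k.
  apply/ler_addgt0Pr => e e0.
  have [t /andP[t0 _]] := directional_approximation k dF e0.
  rewrite dFu ler_norml => /andP[_ approx].
  have := sgv (x + t *: k); rewrite addrAC subrr add0r ipZr.
  by move=> sg; rewrite -(ler_pM2l t0); lra.
move=> k; apply/eqP; rewrite eq_le le_vu/=.
by have := le_vu (- k); rewrite !ipNr lerN2.
Qed.

(** Apply the subgradient inequality at a point close to [x] on the segment to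
    [y]: strong convexity adds [mu / 2 * (1 - t)] times the squared distance. *)
Lemma strongly_convex_subgradient mu F x u y : real_strongly_convex mu F ->
  subgradient F x u -> F x + ip u (y - x) + mu / 2 * `|y - x| ^+ 2 <= F y.
Proof.
move=> scF sgu.
apply: (@le_of_small_error _ _ _ (mu / 2 * `|y - x| ^+ 2)) => t t01.
have /andP[t0 _] := t01.
have := scF y x t t01; have := sgu (t *: y + (1 - t) *: x).
have -> : t *: y + (1 - t) *: x - x = t *: (y - x).
  by rewrite scalerBl scale1r scalerBr addrCA addrAC subrr add0r.
rewrite ipZr; set A := F (_ + _); set B := ip _ _; set N := `|_| ^+ 2.
by move=> h1 h2; rewrite -(ler_pM2l t0); lra.
Qed.

Lemma strongly_convex_monotone mu F x y u v : real_strongly_convex mu F ->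
  subgradient F x u -> subgradient F y v ->
  mu * `|x - y| ^+ 2 <= ip (x - y) (u - v).
Proof.
move=> scF sgu sgv.
have := strongly_convex_subgradient y scF sgu.
have := strongly_convex_subgradient x scF sgv.
rewrite (distrC y x) !ipE (ipC ip x u) (ipC ip x v) (ipC ip y u) (ipC ip y v).
by set N := `|_| ^+ 2; lra.
Qed.

(** * Cocoercivity of Lipschitz gradients *)

Section Lipschitz_gradient.
Context (F : H -> R) (D : H -> H) (L : R).
Context (D_sub : forall x, subgradient F x (D x)).
Context (D_lip : forall x y, `|D x - D y| <= L * `|x - y|).

(** The descent inequality with the constant [L] instead of [L / 2] follows from
    the subgradient inequality at [y] and the Lipschitz bound.  Going through the
    midpoint of [x] and [y] replaces a constant [K] by [K / 2 + L / 4], whose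
    fixed point is [L / 2].  This avoids integrating the gradient along the
    segment. *)
Lemma descent_halving n x y : F y <= F x + ip (D x) (y - x) +
  L / 2 * (1 + 2^-1 ^+ n) * `|y - x| ^+ 2.
Proof.
elim: n => [|n IHn] in x y *.
  have := D_sub y x; have := ip_le_norm hip (D y - D x) (y - x).
  have := ler_wpM2r (normr_ge0 (y - x)) (D_lip y x).
  rewrite expr0 -(opprB y x) ipNr ipDl ipNl.
  by set N := `|y - x|; set M := `|D y - D x|; lra.
pose m := 2^-1 *: (x + y).
have ym : y - m = 2^-1 *: (y - x).
  by apply: (ip_inj hip) => v; rewrite /m !ipE; field.
have mx : m - x = 2^-1 *: (y - x).
  by apply: (ip_inj hip) => v; rewrite /m !ipE; field.
have := IHn x m; have := IHn m y.
have := ip_le_norm hip (D m - D x) (y - m).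
have := ler_wpM2r (normr_ge0 (y - m)) (D_lip m x).
rewrite ym mx normrZ gtr0_norm ?invr_gt0// !ipZr ipDl ipNl (exprS _ n) exprMn.
by set N := `|y - x|; set M := `|D m - D x|; set w := 2^-1 ^+ n; lra.
Qed.

Lemma descent_lemma x y :
  F y <= F x + ip (D x) (y - x) + L / 2 * `|y - x| ^+ 2.
Proof.
have half_cvg : (2^-1 ^+ n : R) @[n --> \oo] --> (0 : R).
  by apply: cvg_expr; rewrite gtr0_norm ?invr_gt0//; lra.
pose bound (w : R) := F x + ip (D x) (y - x) + L / 2 * (1 + w) * `|y - x| ^+ 2.
have <- : bound 0 = F x + ip (D x) (y - x) + L / 2 * `|y - x| ^+ 2.
  by rewrite /bound addr0 mulr1.
apply: (@cvgr_to_ge _ \oo _ R (fun n => bound (2^-1 ^+ n))).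
  apply: cvgD; first exact: cvg_cst.
  by apply: cvgMl; apply: cvgMr; apply: cvgD => //; exact: cvg_cst.
by near=> n; exact: descent_halving.
Unshelve. all: by end_near. Qed.

(** Compare [F] at the gradient step [w] from [y] with the tangent at [x], which
    lies below, and with the quadratic upper model at [y].  The step [w]
    minimizes the gap between the model and the tangent. *)
Lemma lower_bound_from_gradients x y : 0 < L ->
  F x + ip (D x) (y - x) + (2 * L)^-1 * `|D y - D x| ^+ 2 <= F y.
Proof.
move=> L0; pose w := y - L^-1 *: (D y - D x).
have := D_sub x w; have := descent_lemma y w.
have -> : w - y = - (L^-1 *: (D y - D x)) by rewrite /w addrAC subrr add0r.
have -> : w - x = (y - x) - L^-1 *: (D y - D x) by rewrite /w addrAC.
rewrite normrN normrZ gtr0_norm ?invr_gt0// exprMn.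
rewrite (ipDr ip (D x)) !ipNr !ipZr => up low.
have N2 : ip (D y) (D y - D x) - ip (D x) (D y - D x) = `|D y - D x| ^+ 2.
  by rewrite hip ipDl ipNl.
have -> : (2 * L)^-1 * `|D y - D x| ^+ 2 = L^-1 * `|D y - D x| ^+ 2
    - L / 2 * (L^-1 ^+ 2 * `|D y - D x| ^+ 2).
  by field; exact: lt0r_neq0.
by have /= := congr1 ( *%R L^-1) N2; rewrite mulrBr; lra.
Qed.

(** Add the lower bounds obtained by exchanging [x] and [y]. *)
Lemma baillon_haddad x y : 0 < L ->
  L^-1 * `|D x - D y| ^+ 2 <= ip (x - y) (D x - D y).
Proof.
move=> L0; have := lower_bound_from_gradients x y L0.
have := lower_bound_from_gradients y x L0.
rewrite (distrC (D y)) invfM; set N := `|_| ^+ 2.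
rewrite !ipE (ipC ip x (D x)) (ipC ip x (D y)) (ipC ip y (D x)) (ipC ip y (D y)).
by lra.
Qed.

End Lipschitz_gradient.
End Gradient.

(** * Smooth convex functions and their proximal points *)

Section Smooth_convex.
Context {R : realType} {H : completeNormedModType R}.
Context (ip : {dot H for (@idfun R)}) (hip : norm_induced_by ip).
Implicit Types (f g : H -> \bar R) (x y u v : H) (gamma beta mu : R).

Lemma gradient_subgradient f x : convex_efun f -> differentiable_everywhere f ->
  subgradient ip (fine \o f) x (gradient ip f x).
Proof.
move=> cf df; apply: differential_subgradient.
- by apply: fine_convex => // y; have [] := df y.
- by have [] := df x.
- by apply: differential_gradient => //; have [] := df x.
Qed.

Lemma subgradient_gradient f x u : differentiable_everywhere f ->
  subgradient ip (fine \o f) x u -> u = gradient ip f x.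
Proof.
move=> df; have [_ dfx] := df x.
exact: (subgradient_differential hip dfx (differential_gradient hip dfx)).
Qed.

Lemma gradient_cocoercive f beta x y : 0 < beta ->
  convex_efun f -> differentiable_everywhere f ->
  (1 / beta).-lipschitz (gradient ip f) ->
  beta * `|gradient ip f x - gradient ip f y| ^+ 2 <=
    ip (x - y) (gradient ip f x - gradient ip f y).
Proof.
move=> beta0 cf df lipf; rewrite -[X in X * _]invrK -[beta^-1]mul1r.
apply: (baillon_haddad hip (F := fine \o f)).
- by move=> z; exact: gradient_subgradient.
- by move=> z w; exact: (lipf (z, w)).
- by rewrite divr_gt0.
Qed.

(** The objective defining the proximal point is strongly convex, and bounded
    below because [f] lies above its tangent at [x]; so the minimum is attained.
    The subgradient inequality is its first-order optimality condition. *)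
Lemma prox_subgradient gamma f x : 0 < gamma ->
  convex_efun f -> differentiable_everywhere f ->
  subgradient ip (fine \o f) (prox gamma f x) (gamma^-1 *: (x - prox gamma f x)).
Proof.
move=> gamma0 cf df.
have finf y : f y \is a fin_num by have [] := df y.
have rcf := fine_convex finf cf.
pose q := (2 * gamma)^-1; have q0 : 0 < q by rewrite invr_gt0 mulr_gt0.
pose G y := fine (f y) + q * `|y - x| ^+ 2.
have ctsG : continuous G.
  move=> y; apply: cvgD.
    by have [_ dfy] := df y; exact: (differentiable_continuous dfy).
  apply: cvgMr.
  apply: (@continuous_comp _ _ _ (fun y => `|y - x|) (fun r => r ^+ 2)).
    apply: continuous_comp; last exact: norm_continuous.
    by apply: cvgB => //; exact: cvg_cst.
  exact: exprn_continuous.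
pose v := gradient ip f x.
have bG y : setT y -> fine (f x) - gamma / 2 * `|v| ^+ 2 <= G y.
  move=> _; have := gradient_subgradient x cf df y.
  have := ip_ge0 hip ((y - x) + gamma *: v).
  rewrite /G !hip /= -/v; move: (y - x) => w.
  rewrite !ipE (ipC ip w v) => sq sg.
  (* Complete the square: the minimum of [<v, w> + |w|^2 / (2 gamma)] over [w]
     is at [w = - gamma v]. *)
  have sq' : 0 <= q * (ip w w + gamma * ip v w +
      (gamma * ip v w + gamma * (gamma * ip v v))) by rewrite mulr_ge0// ltW.
  have qE : q * (ip w w + gamma * ip v w +
      (gamma * ip v w + gamma * (gamma * ip v v))) =
      q * ip w w + ip v w + gamma / 2 * ip v v.
    by rewrite /q; field; exact: lt0r_neq0.
  by move: sq'; rewrite qE; lra.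
have midG y z : setT y -> setT z -> setT (2^-1 *: (y + z)) /\
    G (2^-1 *: (y + z)) + q / 4 * `|y - z| ^+ 2 <= (G y + G z) / 2.
  move=> _ _; split => //.
  have half01 : 0 < (2^-1 : R) < 1 by lra.
  have := rcf y z 2^-1 half01.
  have -> : 1 - 2^-1 = 2^-1 :> R by lra.
  rewrite -scalerDr !mul0r addr0 /G /= !hip !ipE.
  rewrite (ipC ip z y) (ipC ip x y) (ipC ip x z).
  by set A := fine (f (_ *: _)); lra.
have [||p _ minp] := strongly_convex_minimizer _ closedT _ ctsG bG midG.
- by rewrite divr_gt0.
- by exists 0.
have : forall y, (f (prox gamma f x) + ((2 * gamma)^-1 * `|prox gamma f x - x| ^+ 2)%:E
     <= f y + ((2 * gamma)^-1 * `|y - x| ^+ 2)%:E)%E.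
  apply: (@getPex _ [set p | forall y,
    (f p + ((2 * gamma)^-1 * `|p - x| ^+ 2)%:E
     <= f y + ((2 * gamma)^-1 * `|y - x| ^+ 2)%:E)%E]).
  exists p => y; rewrite -(fineK (finf p)) -(fineK (finf y)) -!EFinD lee_fin.
  exact: minp.
move: (prox gamma f x) => {minp}p minp y.
apply: (@le_of_small_error _ _ _ (q * `|y - p| ^+ 2)) => t t01.
have := minp (t *: y + (1 - t) *: p).
rewrite -(fineK (finf p)) -(fineK (finf (_ + _))) -!EFinD lee_fin -/q.
have := rcf y p t t01; rewrite !mul0r addr0.
have -> : t *: y + (1 - t) *: p - x = (p - x) + t *: (y - p).
  by apply: (ip_inj hip) => w; rewrite !ipE; ring.
have /andP[t0 _] := t01.
rewrite ipZl -(opprB p x) ipNl !hip; move: (p - x) (y - p) => w k.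
have -> : gamma^-1 = 2 * q by rewrite /q; field; exact: lt0r_neq0.
rewrite [ip (w + _) _]ipDl !ipDr !ipZl !ipZr (ipC ip k w) /=.
set A := fine (f (_ + _)) => conv min_p.
by rewrite -(ler_pM2l t0); lra.
Qed.

End Smooth_convex.

(** * One step of the iteration, in terms of difference vectors *)

Section Contraction.
Context {R : realType} {H : completeNormedModType R}.
Context (ip : {dot H for (@idfun R)}) (hip : norm_induced_by ip).
Context (a b d G U : H) (gamma lambda c : R).
Context (gamma0 : 0 < gamma) (lambda0 : 0 < lambda) (c0 : 0 < c).
Context (resolvent : gamma *: U = 2 *: b - a - gamma *: G - d).
Context (b_proj : ip b d = ip b b).

(** The cross term [<d, a - b>] is eliminated with the resolvent equation paired
    with [a] and with [<b, d> = <b, b>]; only [<a - b, G>] has no sign, and Young's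
    inequality splits it with weight [c]. *)
Lemma fdrs_step_bound :
  `|d + lambda *: (a - b)| ^+ 2 <= `|d| ^+ 2 - lambda *
    (((2 * c - 1) / c - lambda) * `|a - b| ^+ 2 + 2 * gamma * ip a U
      + (2 * gamma * ip b G - c * gamma ^+ 2 * `|G| ^+ 2)).
Proof.
have aU : gamma * ip a U = 2 * ip a b - ip a a - gamma * ip a G - ip a d.
  by rewrite -ipZr resolvent !ipE.
have young : - (2 * gamma * ip (a - b) G)
    <= c^-1 * `|a - b| ^+ 2 + c * gamma ^+ 2 * `|G| ^+ 2.
  rewrite !hip; move: (a - b) => w; have := ip_ge0 hip (w + (c * gamma) *: G).
  rewrite !ipE (ipC ip G w) => sq.
  have : 0 <= c^-1 * (ip w w + c * gamma * ip w G +
    (c * gamma * ip w G + c * gamma * (c * gamma * ip G G))).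
    by rewrite mulr_ge0// invr_ge0 ltW.
  have -> : c^-1 * (ip w w + c * gamma * ip w G +
    (c * gamma * ip w G + c * gamma * (c * gamma * ip G G))) =
    c^-1 * ip w w + 2 * gamma * ip w G + c * gamma ^+ 2 * ip G G.
    by field; exact: lt0r_neq0.
  by lra.
have expand : `|d + lambda *: (a - b)| ^+ 2 = `|d| ^+ 2 - lambda *
    ((2 - lambda) * `|a - b| ^+ 2 + 2 * gamma * ip a U + 2 * gamma * ip b G
     + 2 * gamma * ip (a - b) G).
  rewrite -[2 * gamma * ip a U]mulrA aU !hip !ipE.
  rewrite (ipC ip d a) (ipC ip b a) (ipC ip d b) b_proj; ring.
rewrite expand lerD2l lerN2 ler_pM2l//.
have -> : (2 * c - 1) / c = 2 - c^-1 by field; exact: lt0r_neq0.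
by lra.
Qed.

(** By Cauchy-Schwarz, cocoercivity bounds [|u|] by [|x| / beta]. *)
Lemma cocoercive_norm_sub beta (x u : H) : 0 < beta ->
  beta * `|u| ^+ 2 <= ip x u -> `|x - gamma *: u| <= (1 + gamma / beta) * `|x|.
Proof.
move=> beta0 coco.
have le_u : `|u| <= beta^-1 * `|x|.
  have [->|u0] := eqVneq u 0; first by rewrite normr0 mulr_ge0// invr_ge0 ltW.
  rewrite -(ler_pM2l beta0) mulVKf ?lt0r_neq0//.
  rewrite -(@ler_pM2r _ `|u|) ?normr_gt0// -mulrA -expr2.
  exact: le_trans coco (ip_le_norm hip _ _).
apply: le_trans (ler_normB _ _) _.
by rewrite normrZ gtr0_norm// mulrDl mul1r lerD2l -mulrA ler_pM2l.
Qed.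

(** The passage from a decrease [E] to a linear rate: each [E i] dominates [m]
    times the piece [S i], and the pieces together dominate the squared norm up
    to the factor [3].  If [1 - lambda / 3 * m] is negative, the hypotheses force
    [X] to be [0], in accordance with [Num.sqrt] vanishing there. *)
Lemma contraction_factor (X Y m E1 E2 E3 S1 S2 S3 : R) :
  0 <= X -> 0 <= Y -> 0 <= m ->
  X ^+ 2 <= Y ^+ 2 - lambda * (E1 + E2 + E3) ->
  Y ^+ 2 <= 3 * (S1 + S2 + S3) ->
  m * S1 <= E1 -> m * S2 <= E2 -> m * S3 <= E3 ->
  X <= Num.sqrt (1 - lambda / 3 * m) * Y.
Proof.
move=> X0 Y0 m0 drop le3 l1 l2 l3.
have le_mY : lambda * (m * Y ^+ 2) <= lambda * (3 * (E1 + E2 + E3)).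
  rewrite ler_pM2l//; apply: le_trans (ler_wpM2l m0 le3) _; lra.
rewrite -(ger0_norm X0) -(ger0_norm Y0) -!sqrtr_sqr mulrC -sqrtrM ?sqr_ge0//.
by apply: ler_wsqrtr; lra.
Qed.

Section Rates.
Context (betaV betaf : R) (betaV0 : 0 < betaV) (betaf0 : 0 < betaf).
Context (step_size : c * gamma < betaV) (lambda_lt : lambda < (2 * c - 1) / c).
Context (G_coco : betaV * `|G| ^+ 2 <= ip b G).
Context (U_coco : betaf * `|U| ^+ 2 <= ip a U).

(** The hypothesis [c gamma < betaV] lets half of [2 gamma <b, G>] absorb
    [c gamma^2 |G|^2]; the other half supplies [gamma mug |b|^2], which controls
    the piece [b - gamma G]. *)
Lemma contraction_strongly_convex_smooth_part mug : 0 <= mug ->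
  mug * `|b| ^+ 2 <= ip b G ->
  `|d + lambda *: (a - b)| <= C1 gamma c betaV betaf mug lambda * `|d|.
Proof.
move=> mug0 G_mono; rewrite /C1.
set m1 := gamma * mug / _; set m2 := betaf / gamma; set m3 := _ - lambda.
set m := Num.min _ _.
have k0 : 0 < 1 + gamma / betaV by rewrite addr_gt0// divr_gt0.
have m1_0 : 0 <= m1 by rewrite divr_ge0 ?sqr_ge0// mulr_ge0// ltW.
have m2_0 : 0 <= m2 by rewrite divr_ge0 ?ltW.
have m3_0 : 0 <= m3 by rewrite subr_ge0 ltW.
have m_0 : 0 <= m by rewrite !le_min m1_0 m2_0.
have lem1 : m <= m1 by rewrite ge_min lexx.
have lem2 : m <= m2 by rewrite !ge_min lexx orbT.
have lem3 : m <= m3 by rewrite !ge_min lexx !orbT.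
apply: (contraction_factor _ _ m_0 fdrs_step_bound
  (S1 := `|a - b| ^+ 2) (S2 := `|gamma *: U| ^+ 2)
  (S3 := `|b - gamma *: G| ^+ 2)) => //.
- have -> : d = - (a - b) + - (gamma *: U) + (b - gamma *: G).
    by rewrite resolvent; apply: (ip_inj hip) => v; rewrite !ipE; ring.
  by apply: le_trans (norm_sum3_sqr hip _ _ _) _; rewrite !normrN.
- by rewrite ler_wpM2r// exprn_ge0.
- rewrite normrZ gtr0_norm// exprMn.
  have U0 : 0 <= betaf * gamma * `|U| ^+ 2.
    by rewrite mulr_ge0 ?exprn_ge0// mulr_ge0// ltW.
  apply: (@le_trans _ _ (m2 * (gamma ^+ 2 * `|U| ^+ 2))).
    by rewrite ler_wpM2r// mulr_ge0// exprn_ge0// ltW.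
  have -> : m2 * (gamma ^+ 2 * `|U| ^+ 2) = gamma * (betaf * `|U| ^+ 2).
    by rewrite /m2; field; exact: lt0r_neq0.
  have := ler_wpM2l (ltW gamma0) U_coco; lra.
- apply: (@le_trans _ _ (m1 * ((1 + gamma / betaV) ^+ 2 * `|b| ^+ 2))).
    apply: (@le_trans _ _ (m * ((1 + gamma / betaV) ^+ 2 * `|b| ^+ 2))).
      rewrite ler_wpM2l// -exprMn lerXn2r ?nnegrE ?mulr_ge0 ?(ltW k0)//.
      exact: cocoercive_norm_sub.
    by rewrite ler_wpM2r// mulr_ge0// exprn_ge0// ltW.
  rewrite /m1 mulrA divfK ?expf_neq0 ?lt0r_neq0//.
  have G2 : c * gamma * `|G| ^+ 2 <= betaV * `|G| ^+ 2.
    by rewrite ler_wpM2r ?exprn_ge0// ltW.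
  have := ler_wpM2l (ltW gamma0) (le_trans G2 G_coco).
  have := ler_wpM2l (ltW gamma0) G_mono.
  lra.
Qed.

(** Here [<b, G>] only has to control the piece [gamma G], with what the term
    [c gamma^2 |G|^2] leaves of it; the factor [1 / 4] in the rate comes from the
    piece [2 (a - b)]. *)
Lemma contraction_strongly_convex_proximal_part muf : 0 <= muf ->
  muf * `|a| ^+ 2 <= ip a U ->
  `|d + lambda *: (a - b)| <= C2 gamma c betaV betaf muf lambda * `|d|.
Proof.
move=> muf0 U_mono; rewrite /C2.
set m1 := gamma * muf / _; set m2 := (_ - _) / gamma; set m3 := _ * (_ - lambda).
set m := Num.min _ _.
have k0 : 0 < 1 + gamma / betaf by rewrite addr_gt0// divr_gt0.
have m1_0 : 0 <= m1 by rewrite divr_ge0 ?sqr_ge0// mulr_ge0// ltW.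
have m2_0 : 0 <= m2 by rewrite divr_ge0 ?ltW// subr_gt0.
have m3_0 : 0 <= m3 by rewrite mulr_ge0// subr_ge0 ltW.
have m_0 : 0 <= m by rewrite !le_min m1_0 m2_0.
have lem1 : m <= m1 by rewrite ge_min lexx.
have lem2 : m <= m2 by rewrite !ge_min lexx orbT.
have lem3 : m <= m3 by rewrite !ge_min lexx !orbT.
apply: (contraction_factor _ _ m_0 fdrs_step_bound
  (S1 := `|2 *: (a - b)| ^+ 2) (S2 := `|a - gamma *: U| ^+ 2)
  (S3 := `|gamma *: G| ^+ 2)) => //.
- have -> : d = - (2 *: (a - b)) + (a - gamma *: U) + - (gamma *: G).
    by rewrite resolvent; apply: (ip_inj hip) => v; rewrite !ipE; ring.
  by apply: le_trans (norm_sum3_sqr hip _ _ _) _; rewrite !normrN.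
- rewrite normrZ gtr0_norm// exprMn mulrA ler_wpM2r ?exprn_ge0//.
  by move: lem3; rewrite /m3; lra.
- apply: (@le_trans _ _ (m1 * ((1 + gamma / betaf) ^+ 2 * `|a| ^+ 2))).
    apply: (@le_trans _ _ (m * ((1 + gamma / betaf) ^+ 2 * `|a| ^+ 2))).
      rewrite ler_wpM2l// -exprMn lerXn2r ?nnegrE ?mulr_ge0 ?(ltW k0)//.
      exact: cocoercive_norm_sub.
    by rewrite ler_wpM2r// mulr_ge0// exprn_ge0// ltW.
  rewrite /m1 mulrA divfK ?expf_neq0 ?lt0r_neq0//.
  have a0 : 0 <= gamma * (muf * `|a| ^+ 2).
    by rewrite mulr_ge0 ?(ltW gamma0)// mulr_ge0// exprn_ge0.
  have := ler_wpM2l (ltW gamma0) U_mono; lra.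
- rewrite normrZ gtr0_norm// exprMn.
  apply: (@le_trans _ _ (m2 * (gamma ^+ 2 * `|G| ^+ 2))).
    by rewrite ler_wpM2r// mulr_ge0// exprn_ge0// ltW.
  have -> : m2 * (gamma ^+ 2 * `|G| ^+ 2) = gamma * (betaV * `|G| ^+ 2)
      - c * gamma ^+ 2 * `|G| ^+ 2.
    by rewrite /m2; field; exact: lt0r_neq0.
  have := ler_wpM2l (ltW gamma0) G_coco.
  have : 0 <= gamma * (betaV * `|G| ^+ 2).
    by rewrite mulr_ge0 ?(ltW gamma0)// mulr_ge0 ?exprn_ge0// ltW.
  lra.
Qed.

End Rates.
End Contraction.

(** * The forward-Douglas-Rachford operator *)

Section Operator.
Context {R : realType} {H : completeNormedModType R}.
Context (ip : {dot H for (@idfun R)}) (hip : norm_induced_by ip).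
Context (V : set H) (hV : submod_closed (mem V)) (hVcl : closed V).
Context (f g : H -> \bar R) (gamma : R).
Context (cf : convex_efun f) (cg : convex_efun g).
Context (df : differentiable_everywhere f) (dg : differentiable_everywhere g).
Implicit Types x y z u v : H.

Let P := orthogonal_projection ip V.
Let h := g \o P.

Lemma projection_differentiable x :
  differentiable (P : H -> H) x /\ 'd (P : H -> H) x = P :> (H -> H).
Proof.
pose Pl : {linear H -> H} :=
  HB.pack P (GRing.isLinear.Build R H H *:%R P (projection_linear hip hV hVcl)).
have ctsP : continuous Pl.
  apply/linear_bounded_continuous/linear_boundedP; exists 1; split => // r r1 y.
  apply: le_trans (projection_norm hip hV hVcl y) _.
  by rewrite -{1}(mul1r `|y|) ler_wpM2r// ltW.
split; first exact: (linear_differentiable (f := Pl)).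
exact: (diff_lin (f := Pl)).
Qed.

Lemma composite_differentiable : differentiable_everywhere h.
Proof.
move=> x; have [fing dgP] := dg (P x); split; first exact: fing.
have [dP _] := projection_differentiable x.
exact: (differentiable_comp dP dgP).
Qed.

Lemma composite_gradient x : gradient ip h x = P (gradient ip g (P x)).
Proof.
apply: (gradient_eq hip).
have [_ dgP] := dg (P x).
have [dP dPE] := projection_differentiable x.
have -> : (fine \o h : H -> R^o) = (fine \o g : H -> R^o) \o (P : H -> H) by [].
rewrite (diff_comp dP dgP) dPE (differential_gradient hip dgP).
apply/funext => y /=.
by rewrite -/P (projection_self_adjoint hip hV hVcl).
Qed.

Lemma composite_convex : convex_efun h.
Proof.
move=> x y t t01.
rewrite /h /= /P (projectionD hip hV hVcl) !(projectionZ hip hV hVcl).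
exact: cg.
Qed.

Let Dh := gradient ip h.
Let forward_reflected z := 2 *: P z - z - gamma *: Dh z.
Let proxpt z := prox gamma f (forward_reflected z).

(** The gradient of [h] lies in [V], so the projection commutes with the forward
    step and the two reflections collapse. *)
Lemma fdrsE z : fdrs ip V gamma f g z = z - P z + proxpt z.
Proof.
rewrite /fdrs -/P -/h /refl_prox /refl_subspace -/P -/Dh.
have PDh : P (Dh z) = Dh z.
  rewrite /Dh composite_gradient /P (projection_id hip hV hVcl)//.
  exact: projection_in.
have -> : P (z - gamma *: Dh z) = P z - gamma *: Dh z.
  by rewrite /P (projectionD hip hV hVcl) (projectionN hip hV hVcl)
    (projectionZ hip hV hVcl) -/P PDh.
have -> : 2 *: (P z - gamma *: Dh z) - (z - gamma *: Dh z) = forward_reflected z.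
  by apply: (ip_inj hip) => v; rewrite /forward_reflected !ipE; ring.
rewrite -/(proxpt z); apply: (ip_inj hip) => v.
by rewrite /forward_reflected !ipE; field.
Qed.

Context (gamma0 : 0 < gamma) (betaV betaf muf mug c : R).
Context (betaV0 : 0 < betaV) (betaf0 : 0 < betaf).
Context (lipf : (1 / betaf).-lipschitz (gradient ip f)).
Context (liph : (1 / betaV).-lipschitz (gradient ip h)).
Context (muf0 : 0 <= muf) (mug0 : 0 <= mug).
Context (scf : strongly_convex muf f) (scg : strongly_convex mug g).
Context (c0 : 0 < c) (step_size : c * gamma < betaV).

(** Supplies the difference vectors and their monotonicity estimates to the two
    rate lemmas.  Pairings of [G] with [d] and with [b] agree because [G] lies in
    [V]; the first is where [h] is cocoercive, the second where [g] is strongly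
    monotone, as [b] is a difference of points of [V]. *)
Lemma fdrs_relaxed_contraction lambda z zs :
  0 < lambda -> lambda < (2 * c - 1) / c -> fdrs ip V gamma f g zs = zs ->
  `|fdrs_relaxed ip V gamma f g lambda z - zs|
    <= C1 gamma c betaV betaf mug lambda * `|z - zs| /\
  `|fdrs_relaxed ip V gamma f g lambda z - zs|
    <= C2 gamma c betaV betaf muf lambda * `|z - zs|.
Proof.
move=> lambda0 lambda_lt fixed.
have proxpt_fixed : proxpt zs = P zs.
  by move: fixed; rewrite fdrsE -addrA => /(canRL (addKr _)); rewrite addrC
    => /eqP; rewrite addNr subr_eq0 => /eqP.
pose U y := gamma^-1 *: (forward_reflected y - proxpt y).
have sgU y : subgradient ip (fine \o f) (proxpt y) (U y).
  exact: prox_subgradient.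
have UE y : U y = gradient ip f (proxpt y) by exact: subgradient_gradient.
pose a := proxpt z - proxpt zs; pose b := P z - P zs; pose d := z - zs.
have -> : fdrs_relaxed ip V gamma f g lambda z - zs = d + lambda *: (a - b).
  rewrite /fdrs_relaxed fdrsE /d /a /b proxpt_fixed.
  by apply: (ip_inj hip) => v; rewrite !ipE; ring.
have bE : P d = b.
  by rewrite /P (projectionD hip hV hVcl) (projectionN hip hV hVcl).
have ip_bd : ip b d = ip b b.
  by rewrite (ipC ip b d) -bE; apply: projection_ortho => //; exact: projection_in.
have resolvent :
    gamma *: (U z - U zs) = 2 *: b - a - gamma *: (Dh z - Dh zs) - d.
  rewrite /U -scalerBr scalerA mulfV ?lt0r_neq0// scale1r.
  rewrite /forward_reflected /a /b /d.
  (* The identity holds whatever the proximal points, projections and gradients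
     are. *)
  move: (proxpt z) (proxpt zs) (P z) (P zs) (Dh z) (Dh zs) => x xs p ps Dz Dzs.
  by apply: (ip_inj hip) => v; rewrite !ipE; ring.
have ip_dG : ip d (Dh z - Dh zs) = ip b (Dh z - Dh zs).
  rewrite -bE /Dh !composite_gradient.
  rewrite -(projectionN hip hV hVcl) -(projectionD hip hV hVcl).
  by apply: projection_ortho => //; exact: projection_in.
have G_coco : betaV * `|Dh z - Dh zs| ^+ 2 <= ip b (Dh z - Dh zs).
  rewrite -ip_dG; apply: gradient_cocoercive => //.
    exact: composite_convex.
  exact: composite_differentiable.
have U_coco : betaf * `|U z - U zs| ^+ 2 <= ip a (U z - U zs).
  by rewrite !UE; exact: gradient_cocoercive.
have U_mono : muf * `|a| ^+ 2 <= ip a (U z - U zs).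
  apply: (strongly_convex_monotone (F := fine \o f)) => //.
  by apply: fine_strongly_convex => // y; have [] := df y.
have G_mono : mug * `|b| ^+ 2 <= ip b (Dh z - Dh zs).
  rewrite /Dh !composite_gradient ipDr ipNr.
  rewrite -!(projection_self_adjoint hip hV hVcl) -bE.
  rewrite /P (projection_id hip hV hVcl (projection_in hip hV hVcl _)) -/P bE.
  rewrite -ipNr -ipDr.
  apply: (strongly_convex_monotone (F := fine \o g)) => //.
  - by apply: fine_strongly_convex => // y; have [] := dg y.
  - exact: gradient_subgradient.
  - exact: gradient_subgradient.
split.
  exact: (contraction_strongly_convex_smooth_part hip _ _ _ resolvent ip_bd).
exact: (contraction_strongly_convex_proximal_part hip _ _ _ resolvent ip_bd).
Qed.

End Operator.

(** * Linear convergence *)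

Lemma iterated_contraction {R : numDomainType} (r C : nat -> R) :
  (forall k, 0 <= C k) -> (forall k, r k.+1 <= C k * r k) ->
  forall k, r k.+1 <= r 0%N * \prod_(i < k.+1) C i.
Proof.
move=> C0 step; elim => [|k IHk]; first by rewrite big_ord1 mulrC.
rewrite big_ord_recr/= mulrA mulrC; apply: le_trans (step _) _.
exact: ler_wpM2l.
Qed.

Theorem theorem6p1 (R : realType) (H : completeNormedModType R)
  (ip : {dot H for (@idfun R)}) (hip : norm_induced_by ip)
  (V : set H) (hV : submod_closed (mem V)) (hVcl : closed V)
  (f g : H -> \bar R)
  (hf : closed_proper_convex f) (hg : closed_proper_convex g)
  (beta : R) (hbeta : 0 < beta)
  (hgdiff : differentiable_everywhere g)
  (hglip : (1 / beta).-lipschitz (gradient ip g))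
  (betaV : R) (hbetaV : 0 < betaV)
  (hhlip : (1 / betaV).-lipschitz
             (gradient ip (g \o orthogonal_projection ip V)))
  (hsol : exists x u v, [/\ subdifferential ip f x u,
     subdifferential ip (indicator V) x v & 0 = u + gradient ip g x + v])
  (muf mug : R) (hmuf : 0 <= muf) (hmug : 0 <= mug)
  (hfsc : strongly_convex muf f) (hgsc : strongly_convex mug g)
  (betaf : R) (hbetaf : 0 <= betaf)
  (hfsmooth : 0 < betaf ->
     differentiable_everywhere f /\ (1 / betaf).-lipschitz (gradient ip f))
  (gamma : R) (hgamma : 0 < gamma < 2 * betaV)
  (alpha : R) (halpha : alpha = 2 * betaV / (4 * betaV - gamma))
  (lambda : nat -> R) (hlambda : forall j, 0 < lambda j < 1 / alpha)
  (z : nat -> H)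
  (hz : forall k, z k.+1 = fdrs_relaxed ip V gamma f g (lambda k) (z k))
  (zs : H) (hzs : fdrs ip V gamma f g zs = zs)
  (xs : H) (hxs : xs = orthogonal_projection ip V zs)
  (c : R) (hc : 1 / 2 < c) (hgammac : gamma < betaV / c)
  (hlambdac : forall j, 0 < lambda j < (2 * c - 1) / c) :
  forall k : nat,
    (0 < mug * betaf ->
       `|z k.+1 - zs| <= C1 gamma c betaV betaf mug (lambda k) * `|z k - zs|
       /\ `|z k.+1 - zs| <= `|z 0%N - zs| *
            \prod_(i < k.+1) C1 gamma c betaV betaf mug (lambda i))
    /\
    (0 < muf * betaf ->
       `|z k.+1 - zs| <= C2 gamma c betaV betaf muf (lambda k) * `|z k - zs|
       /\ `|z k.+1 - zs| <= `|z 0%N - zs| *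
            \prod_(i < k.+1) C2 gamma c betaV betaf muf (lambda i)).
Proof.
have c0 : 0 < c by lra.
have step_size : c * gamma < betaV by rewrite mulrC -ltr_pdivlMr.
have gamma0 : 0 < gamma by case/andP: hgamma.
have [_ _ cf] := hf; have [_ _ cg] := hg.
have step : 0 < betaf -> forall j,
    `|z j.+1 - zs| <= C1 gamma c betaV betaf mug (lambda j) * `|z j - zs| /\
    `|z j.+1 - zs| <= C2 gamma c betaV betaf muf (lambda j) * `|z j - zs|.
  move=> betaf0 j; have [df lipf] := hfsmooth betaf0.
  have /andP[lambda0 lambda_lt] := hlambdac j.
  rewrite hz; exact: (fdrs_relaxed_contraction hip hV hVcl).
have betaf_gt0 mu : 0 < mu * betaf -> 0 < betaf.
  move=> mubetaf; rewrite lt0r hbetaf andbT.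
  by apply: contraTneq mubetaf => ->; rewrite mulr0 ltxx.
move=> k; split=> /betaf_gt0/step {}step.
  split; first by case: (step k).
  apply: (@iterated_contraction _ (fun j => `|z j - zs|)
    (fun j => C1 gamma c betaV betaf mug (lambda j))) => j.
    exact: sqrtr_ge0.
  by case: (step j).
split; first by case: (step k).
apply: (@iterated_contraction _ (fun j => `|z j - zs|)
  (fun j => C2 gamma c betaV betaf muf (lambda j))) => j.
  exact: sqrtr_ge0.
by case: (step j).
Qed.
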